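(* Let $Y\in\mathcal{G}$. Then for all $n\in\mathbb{N}_0$ and $x\ge0$, $$W_{n+1}^Y(x)=x\sum_{k=0}^n\binom{n}{k}\,\mathbb{E}[Y^{n-k+1}]\sum_{i=0}^k\binom{k}{i}W_i^Y(x)\,W_{k-i}^Y(x).$$
   Context: $\mathbb{N}_0=\{0,1,2,\dots\}$. $\mathcal{G}$ is the set of real random variables $Y$ such that $\mathbb{E}|Y|^n<\infty$ for all $n\in\mathbb{N}_0$ and, for some $r>0$, $\lim_{n\to\infty}|t|^n\mathbb{E}|Y|^n/n!=0$ for all $|t|<r$. Let $Y_1,Y_2,\dots$ be i.i.d. copies of $Y$, $S_0=0$ and $S_i=Y_1+\cdots+Y_i$ for $i\ge1$. The convention $0^0=1$ is used. For $x\ge0$ the probabilistic Fubini polynomials associated with $Y$ are $$W_n^Y(x)=\sum_{i=0}^{\infty}\mathbb{E}[S_i^n]\,P\{G_{\eta(x)}=i+1\}=\sum_{i=0}^\infty \mathbb{E}[S_i^n]\,\frac{1}{1+x}\left(\frac{x}{1+x}\right)^i,\qquad n\in\mathbb{N}_0,$$ where $\eta(x)=1/(1+x)$ and $G_p$ is geometric with $P\{G_p=i\}=p(1-p)^{i-1}$, $i\ge1$. *)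

(* Defs.v *)
From HB Require Import structures.
From mathcomp Require Import all_boot all_order all_algebra.
From mathcomp Require Import finmap.
From mathcomp Require Import all_classical all_reals all_analysis.

Set Implicit Arguments.
Unset Strict Implicit.
Unset Printing Implicit Defensive.

Import Order.TTheory GRing.Theory Num.Theory.
Import numFieldNormedType.Exports.

Local Open Scope classical_set_scope.
Local Open Scope ring_scope.

Definition mean (R : realType) (d : measure_display) (T : measurableType d)
    (P : probability T R) (X : T -> R) : R :=
  fine 'E_P[X].

(* The first clause makes every [mean P (fun w => `|Y w| ^+ n)] in the second
   one a genuine expectation, not the value of [fine] at [+oo]. *)
Definition class_G (R : realType) (d : measure_display) (T : measurableType d)
    (P : probability T R) (Y : {RV P >-> R}) : Prop :=
  (forall n : nat, ('E_P[fun w => (`|Y w| ^+ n)%R] < +oo)%E) /\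
  (exists2 r : R, 0 < r &
    forall t : R, `|t| < r ->
      `|t| ^+ n * mean P (fun w => `|Y w| ^+ n) / n`!%:R @[n --> \oo] --> 0).

Definition mutually_independent (R : realType) (d : measure_display)
    (T : measurableType d) (P : probability T R) (I : choiceType)
    (X : I -> {RV P >-> R}) : Prop :=
  forall (J : {fset I}) (A : I -> set R),
    (forall i, i \in J -> measurable (A i)) ->
    P (\bigcap_(i in [set` J]) (X i @^-1` A i)) =
      (\prod_(i <- J) P (X i @^-1` A i))%E.

(* The original variable and its copies may live on different spaces. *)
Definition iid_copies (R : realType)
    (d0 : measure_display) (T0 : measurableType d0) (P0 : probability T0 R)
    (Y : {RV P0 >-> R})
    (d : measure_display) (T : measurableType d) (P : probability T R)
    (Ys : nat -> {RV P >-> R}) : Prop :=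
  mutually_independent Ys /\
  (forall (i : nat) (A : set R), measurable A ->
    distribution P (Ys i) A = distribution P0 Y A).

(* The copies are numbered from 0: [Ys j] is Y_(j+1). *)
Definition partial_sum (R : realType) (d : measure_display)
    (T : measurableType d) (P : probability T R)
    (Ys : nat -> {RV P >-> R}) (i : nat) (w : T) : R :=
  \sum_(j < i) Ys j w.

(* The law of the geometric distribution on {1, 2, ...}. *)
Definition geometric_pmf (R : realType) (p : R) (i : nat) : R :=
  if i is j.+1 then p * (1 - p) ^+ j else 0.

Definition eta (R : realType) (x : R) : R := (1 + x)^-1.

(* For Y in the class G and x >= 0 the series converges absolutely, because
   E|S_i|^n <= i^n E|Y|^n; so [limn] is its sum. *)
Definition fubini_W (R : realType) (d : measure_display)
    (T : measurableType d) (P : probability T R)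
    (Ys : nat -> {RV P >-> R}) (n : nat) (x : R) : R :=
  limn (series (fun i : nat =>
    mean P (fun w => partial_sum Ys i w ^+ n) *
      geometric_pmf (eta x) i.+1)).

(* Main.v *)
From HB Require Import structures.
Require Import Defs.
From mathcomp Require Import all_boot all_order all_algebra.
From mathcomp Require Import finmap.
From mathcomp Require Import all_classical all_reals all_analysis.
From mathcomp Require Import measurable_realfun.
From mathcomp Require Import ring.

Set Implicit Arguments.
Unset Strict Implicit.
Unset Printing Implicit Defensive.

Import Order.TTheory GRing.Theory Num.Theory.
Import numFieldNormedType.Exports.

Local Open Scope classical_set_scope.
Local Open Scope ring_scope.

(** Write [m j] for the moments of Y, [a i n] for the moments of the partial
    sums S_i, [p = 1 / (1 + x)] and [q = x / (1 + x)]. Let M be the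
    exponential generating function of [m]. That of the moments of S_i is [M
    ^ i], so the Fubini polynomials W_n are generated by the geometric
    series F = sum_i p q^i M^i, that is, F (1 - q M) = p. Differentiating
    gives F' (1 - q M) = q M' F, and multiplying by F turns the left-hand
    side into p F', so that p F' = q M' F^2. Since q = x p this is F' = x M'
    F^2, whose coefficients are the claimed recurrence ([binconv_riccati]).

    The generating functions are formal: F and M are truncated to polynomials
    and the identities are read below a fixed degree. The relation F (1 - q
    M) = p is the shift i -> i + 1 in the series defining W_n
    ([geometric_sum_binconv_iter]) and rests on two facts:
    - S_i and Y_(i+1) are independent, hence the moments of S_(i+1) are the
      binomial convolution of those of S_i and Y ([mean_partial_sumS]).  The
      independence of the two variables is a monotone class argument
      ([sigma_past_independent]), and the product rule for means is Fubini's
      theorem for their joint law ([mean_independentM]);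
    - each series sum_i q^i a_i(n) converges absolutely
      ([cvg_series_binconv_iter]); because m_0 = 1, the difference
      a_(i+1)(n) - a_i(n) only involves moments of S_i of order less than n, so
      this goes by induction on n. *)

(** * Binomial convolution and exponential generating functions *)

Definition binconv (R : numFieldType) (u v : nat -> R) (n : nat) : R :=
  \sum_(k < n.+1) 'C(n, k)%:R * u k * v (n - k)%N.

Definition egf (R : numFieldType) (N : nat) (u : nat -> R) : {poly R} :=
  \poly_(k < N) (u k / k`!%:R).

Lemma natr_fact_neq0 (R : numFieldType) (n : nat) : n`!%:R != 0 :> R.
Proof. by rewrite pnatr_eq0 -lt0n fact_gt0. Qed.

(** A truncated product is exact below the truncation degree. *)
Lemma coef_egfM (R : numFieldType) (N : nat) (u v : nat -> R) (n : nat) :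
  (n < N)%N -> (egf N u * egf N v)`_n = binconv u v n / n`!%:R.
Proof.
move=> nN; rewrite coefM /binconv mulr_suml; apply: eq_bigr => k _.
have kn : (k <= n)%N by rewrite -ltnS.
rewrite !coef_poly (leq_ltn_trans kn nN) (leq_ltn_trans (leq_subr k n) nN).
have := bin_fact kn => /(congr1 (fun i => i%:R : R)); rewrite !natrM => <-.
have := natr_fact_neq0 R k; have := natr_fact_neq0 R (n - k).
have : 'C(n, k)%:R != 0 :> R by rewrite pnatr_eq0 -lt0n bin_gt0.
by move=> h1 h2 h3; field; rewrite h1 h2 h3.
Qed.

Lemma deriv_egf (R : numFieldType) (N : nat) (u : nat -> R) :
  (egf N.+1 u)^`() = egf N (fun k => u k.+1).
Proof.
apply/polyP => k; rewrite coef_deriv !coef_poly ltnS.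
case: ifP => _; last by rewrite mul0rn.
rewrite -(mulr_natr (_ / _)) factS natrM.
by rewrite invfM mulrA mulrAC divfK// pnatr_eq0.
Qed.

(** The hypothesis is F (1 - q M) = p on exponential generating functions and
    the conclusion p F' = q M' F^2.  With truncated F and M the hypothesis holds
    up to a multiple of 'X^(n.+2), whose derivative is a multiple of 'X^(n.+1),
    so coefficient n of the derived relation is not disturbed. *)
Lemma binconv_riccati (R : numFieldType) (p q : R) (m W : nat -> R) :
  (forall n, W n = (n == 0%N)%:R * p + q * binconv W m n) ->
  forall n, p * W n.+1 =
    q * binconv (binconv W W) (fun k => m k.+1) n.
Proof.
move=> WE n; pose N := n.+1.
pose F := egf N.+1 W; pose M := egf N.+1 m.
pose D := drop_poly N.+1 (F * (1 - q *: M) - p%:P).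
have FE : F * (1 - q *: M) = p%:P + D * 'X^(N.+1).
  rewrite -[LHS](subrK p%:P) [LHS]addrC; congr (_ + _).
  rewrite -[LHS](poly_take_drop N.+1) -/D (_ : take_poly _ _ = 0) ?add0r//.
  apply/polyP => k; rewrite coef_take_poly coef0; case: ifP => // kN.
  rewrite mulrBr mulr1 -scalerAr !coefB coefZ coef_egfM// coefC coef_poly kN.
  rewrite [in X in X - _](WE k).
  case: k kN => [|k] _ /=; last by rewrite mul0r add0r; ring.
  by rewrite fact0 !divr1 mul1r; ring.
(* This is F times the derivative of FE, with F (1 - q M) replaced through
   FE; both remainders keep a factor 'X^N. *)
have dF : p *: F^`() = q *: (F * F * M^`()) +
    (D * (N.+1%:R * F - 'X * F^`()) + 'X * D^`() * F) * 'X^N.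
  have dFE := congr1 (fun r => F * deriv r) FE.
  rewrite /= !(derivM, derivB, derivD, derivC, derivZ, derivXn) in dFE.
  rewrite -mul_polyC -[X in X * _](addrK (D * 'X^(N.+1))) -FE.
  move: dFE; rewrite -!mul_polyC /= -mulr_natl exprS.
  set e := _%:R; set x := 'X^N; move=> dFE.
  apply/eqP; rewrite -subr_eq0; apply/eqP; move/eqP: dFE; rewrite -subr_eq0.
  by move=> /eqP E; rewrite -[RHS]E; ring.
have := congr1 (fun r : {poly R} => r`_n) dF.
rewrite /= coefD coefMXn leqnn addr0 !coefZ /F /M !deriv_egf coefM.
rewrite coef_poly leqnn => E.
have nf := natr_fact_neq0 R n.
have {E} : p * (W n.+1 / n`!%:R) =
   q * (binconv (binconv W W) (fun k => m k.+1) n / n`!%:R).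
  rewrite E; congr (_ * _); rewrite -(@coef_egfM _ n.+1)// coefM.
  apply: eq_bigr => k _; congr (_ * _).
  rewrite coef_egfM; last by rewrite ltnW// ltnS; exact: ltn_ord.
  by rewrite coef_poly ltn_ord.
by rewrite !mulrA => /(mulIf (invr_neq0 nf)).
Qed.

(** * Geometric series of iterated convolutions *)

Lemma bounded_cvg_nonneg_series (R : realType) (f : nat -> R) (M : R) :
  (forall i, 0 <= f i) -> (forall n, series f n <= M) -> cvgn (series f).
Proof.
move=> f0 fM; apply: nondecreasing_is_cvgn.
  by apply: nondecreasing_series => i _ _; exact: f0.
by exists M => _ [n _ <-]; exact: fM.
Qed.

(** With C_n and D_n the partial sums of the two series, the inequality
    |c_(i+1)| <= |c_i| + |d_i| gives C_(n+1) <= |c_0| + q (C_n + D_n). As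
    C_n <= C_(n+1), this bounds (1 - q) C_n by |c_0| + q D, where D is the
    sum of the second series. *)
Lemma cvg_series_of_diff (R : realType) (q : R) (c d : nat -> R) :
  0 <= q -> q < 1 -> (forall i, c i.+1 = c i + d i) ->
  cvgn (series (fun i => `|d i| * q ^+ i)) ->
  cvgn (series (fun i => `|c i| * q ^+ i)).
Proof.
move=> q0 q1 cE dcvg.
have tq (u : nat -> R) i : 0 <= `|u i| * q ^+ i.
  by rewrite mulr_ge0// exprn_ge0.
pose D := limn (series (fun i => `|d i| * q ^+ i)).
have leD n : series (fun i => `|d i| * q ^+ i) n <= D.
  apply: nondecreasing_cvgn_le => //.
  by apply: nondecreasing_series => i _ _; exact: tq.
apply: (@bounded_cvg_nonneg_series _ _ ((`|c 0%N| + q * D) / (1 - q))) => // n.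
rewrite ler_pdivlMr ?subr_gt0// mulrBr mulr1 lerBlDr.
set C := series _.
have CS : C n.+1 <= `|c 0%N| + q * (C n + series (fun i => `|d i| * q ^+ i) n).
  rewrite /C /series /= big_nat_recl//= expr0 mulr1 lerD2l.
  rewrite -big_split mulr_sumr; apply: ler_sum => i _ /=.
  rewrite cE exprS -mulrDl mulrCA ler_wpM2l// ler_wpM2r ?exprn_ge0//.
  exact: ler_normD.
have Cn : C n <= C n.+1 by rewrite /C seriesEnat /= big_nat_recr//= lerDl.
apply: (le_trans Cn); apply: (le_trans CS).
by rewrite mulrDr addrA addrAC [q * C n]mulrC !lerD2r lerD2l ler_wpM2l.
Qed.

Lemma cvg_lim_series_sum (R : realType) (I : Type) (r : seq I)
    (f : I -> nat -> R) :
  (forall k, cvgn (series (f k))) ->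
  series (fun i => \sum_(k <- r) f k i) @ \oo -->
    \sum_(k <- r) limn (series (f k)).
Proof.
move=> fc.
rewrite (_ : series _ = fun n => \sum_(k <- r) series (f k) n).
  by apply: (@cvg_big _ _ +%R 0) => // *; exact: add_continuous.
by apply/funext => n; rewrite /series /= exchange_big.
Qed.

(** Strong induction on n: in the recurrence the term of index n is a_i(n)
    itself because m_0 = 1, so the increment of a_i(n) is a combination of
    the a_i(k) with k < n, whose series converge by induction. *)
Lemma cvg_series_binconv_iter (R : realType) (q : R) (a : nat -> nat -> R)
    (m : nat -> R) (n : nat) :
  0 <= q -> q < 1 -> m 0%N = 1 ->
  (forall i k, a i.+1 k = binconv (a i) m k) ->
  cvgn (series (fun i => `|a i n| * q ^+ i)).
Proof.
move=> q0 q1 m0 aS; have [N] := ubnP n; elim: N => // N IH in n *.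
rewrite ltnS => nN.
pose c k := 'C(n, k)%:R * m (n - k)%N.
apply: (@cvg_series_of_diff _ q (a ^~ n)
  (fun i => \sum_(k < n) c k * a i k)) => //.
  move=> i; rewrite aS /binconv big_ord_recr /= binn mul1r subnn m0 mulr1 addrC.
  by congr (_ + _); apply: eq_bigr => k _; rewrite mulrAC.
pose g i := \sum_(k < n) `|c k| * (`|a i k| * q ^+ i).
have gcvg : cvgn (series g).
  apply/cvg_ex; eexists; apply: cvg_lim_series_sum => k.
  by apply: is_cvg_seriesZ; apply: IH; apply: leq_trans (ltn_ord k) nN.
apply: (series_le_cvg _ _ _ gcvg) => i.
- by rewrite mulr_ge0// exprn_ge0.
- by apply: sumr_ge0 => k _; rewrite !mulr_ge0// exprn_ge0.
- rewrite /g (le_trans (ler_wpM2r _ (ler_norm_sum _ _ _)))// ?exprn_ge0//.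
  rewrite mulr_suml; apply: ler_sum => k _.
  by rewrite normrM mulrA.
Qed.

(** Splitting off the term i = 0 leaves the series of a_(i+1)(n) p q^(i+1), in
    which the recurrence can be summed term by term. *)
Lemma geometric_sum_binconv_iter (R : realType) (p q : R) (a : nat -> nat -> R)
    (m : nat -> R) :
  0 <= q -> q < 1 -> m 0%N = 1 -> (forall k, a 0%N k = (k == 0%N)%:R) ->
  (forall i k, a i.+1 k = binconv (a i) m k) ->
  let W n := limn (series (fun i => a i n * (p * q ^+ i))) in
  forall n, W n = (n == 0%N)%:R * p + q * binconv W m n.
Proof.
move=> q0 q1 m0 a0 aS W n.
pose u k i : R := a i k * (p * q ^+ i).
have uc k : cvgn (series (u k)).
  apply: normed_cvg.
  rewrite (_ : [normed _] = series (`|p| *: (fun i => `|a i k| * q ^+ i))).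
    by apply: is_cvg_seriesZ; exact: cvg_series_binconv_iter aS.
  congr series; apply/funext => i.
  rewrite -[LHS]/(`|u k i|) -[RHS]/(`|p| * (`|a i k| * q ^+ i)) /u.
  by rewrite !normrM normrX (ger0_norm q0) mulrCA.
pose c k := q * ('C(n, k)%:R * m (n - k)%N).
have : series (u n) (N.+1) @[N --> \oo] -->
    u n 0%N + \sum_(k < n.+1) limn (series (fun i => c k * u k i)).
  have -> : (fun N => series (u n) N.+1) = (fun N => u n 0%N +
      series (fun i => \sum_(k < n.+1) c k * u k i) N).
    apply/funext => N; rewrite /series /= big_nat_recl//; congr (_ + _).
    apply: eq_bigr => i _; rewrite /u aS /binconv mulr_suml.
    by apply: eq_bigr => k _; rewrite /c exprS; ring.
  apply: cvgD; first exact: cvg_cst.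
  by apply: cvg_lim_series_sum => k; exact: is_cvg_seriesZ.
rewrite (cvg_shiftS (series (u n))) => /cvg_lim uE.
rewrite -[LHS]/(limn (series (u n))) uE//.
rewrite /u a0 expr0 mulr1 mulr_sumr; congr (_ + _); apply: eq_bigr => k _.
by rewrite (lim_seriesZ (c k) (uc k)) -[LHS]/(c k * W k) /c; ring.
Qed.

(** * Means and independent variables *)

Lemma integral_mean (R : realType) (d : measure_display) (T : measurableType d)
    (P : probability T R) (f : T -> R) :
  P.-integrable setT (EFin \o f) -> (\int[P]_w (f w)%:E)%E = (mean P f)%:E.
Proof.
by move=> intf; rewrite /mean unlock fineK//; exact: integrable_fin_num.
Qed.

Lemma mean_cst (R : realType) (d : measure_display) (T : measurableType d)
    (P : probability T R) (c : R) : mean P (fun=> c) = c.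
Proof. by rewrite /mean (expectation_cst P c). Qed.

Definition independent_pair (R : realType) (d : measure_display)
    (T : measurableType d) (P : probability T R) (X Z : {RV P >-> R}) : Prop :=
  forall A B : set R, measurable A -> measurable B ->
    P (X @^-1` A `&` Z @^-1` B) = (P (X @^-1` A) * P (Z @^-1` B))%E.

Section product_law.
Context (R : realType) (d : measure_display) (T : measurableType d)
  (P : probability T R).
Variables (X Z : {RV P >-> R}).
Hypothesis XZ : independent_pair X Z.

Let mXZ : measurable_fun [set: T] (fun w => (X w, Z w)).
Proof. exact: measurable_fun_pair. Qed.

(** A measure on the plane is determined by its values on rectangles, where
    this is the definition of independence. *)
Lemma joint_law_product (A : set (R * R)) : measurable A ->
  (distribution P X \x distribution P Z)%E A =
  pushforward P (fun w => (X w, Z w)) A.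
Proof.
pose XZ' : {mfun T >-> (R * R)%type} := HB.pack (fun w => (X w, Z w))
  (isMeasurableFun.Build _ _ _ _ _ mXZ).
move=> mA.
by rewrite (product_measure_unique (m' := distribution P XZ')).
Qed.

Lemma ge0_integral_joint_law (h : R * R -> \bar R) :
  measurable_fun [set: R * R] h -> (forall z, (0 <= h z)%E) ->
  (\int[P]_w h (X w, Z w) =
   \int[distribution P X \x distribution P Z]_z h z)%E.
Proof.
move=> mh h0.
rewrite [RHS](eq_measure_integral (pushforward P (fun w => (X w, Z w)))).
  by rewrite ge0_integral_pushforward.
by move=> A mA _; exact: joint_law_product.
Qed.

Variables f g : R -> R.
Hypotheses (mf : measurable_fun setT f) (mg : measurable_fun setT g).
Hypotheses (intf : P.-integrable setT (EFin \o (f \o X)))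
  (intg : P.-integrable setT (EFin \o (g \o Z))).

Let h (z : R * R) : \bar R := (f z.1 * g z.2)%:E.

Let mh : measurable_fun [set: R * R] h.
Proof.
by apply/measurable_EFinP; apply: measurable_funM; apply: measurableT_comp.
Qed.

(* Tonelli: the integral of the absolute value is the product of two finite
   ones. *)
Let inth : (distribution P X \x distribution P Z)%E.-integrable setT h.
Proof.
apply/integrable12ltyP => //.
have mabs (k : R -> R) : measurable_fun setT k ->
    measurable_fun setT (fun y => `|k y|%:E).
  by move=> mk; apply/measurable_EFinP; exact: measurableT_comp.
under eq_integral.
  move=> x _; under eq_integral do rewrite /h /= normrM EFinM.
  rewrite ge0_integralZl//; last exact: mabs.
  over.
rewrite ge0_integralZr//; [|exact: mabs|exact: integral_ge0].
rewrite !ge0_integral_distribution//; [|exact: mabs|exact: mabs].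
have /integrableP[_ foo] := intf; have /integrableP[_ goo] := intg.
have X0 : (0 <= \int[P]_w `|f (X w)|%:E)%E.
  by apply: integral_ge0 => w _; rewrite lee_fin.
by apply: lte_mul_pinfty => //; rewrite ge0_fin_numE.
Qed.

Lemma integrable_independentM :
  P.-integrable setT (EFin \o (fun w => f (X w) * g (Z w))).
Proof.
apply/integrableP; split; first exact: (measurableT_comp mh mXZ).
rewrite (ge0_integral_joint_law (h := fun z => `|h z|%E))//.
  by have /integrableP[] := inth.
exact: measurableT_comp.
Qed.

Lemma mean_independentM :
  mean P (fun w => f (X w) * g (Z w)) = mean P (f \o X) * mean P (g \o Z).
Proof.
apply: EFin_inj; rewrite -integral_mean; last exact: integrable_independentM.
rewrite EFinM -!integral_mean//.
transitivity (\int[pushforward P (fun w => (X w, Z w))]_z h z)%E.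
  by rewrite integral_pushforward//; exact: integrable_independentM.
transitivity (\int[distribution P X \x distribution P Z]_z h z)%E.
  by apply/esym/eq_measure_integral => A mA _; exact: joint_law_product.
rewrite -integral12_prod_meas1// /fubini_F /h /=.
have lawg : (\int[distribution P Z]_y (g y)%:E = (mean P (g \o Z))%:E)%E.
  rewrite integral_distribution//; last exact/measurable_EFinP.
  exact: integral_mean.
under eq_integral.
  move=> x _; under eq_integral do rewrite EFinM.
  rewrite integralZl//; last first.
    by apply: integrable_pushforward => //; exact/measurable_EFinP.
  rewrite lawg; over.
rewrite integralZr//; last first.
  by apply: integrable_pushforward => //; exact/measurable_EFinP.
rewrite integral_distribution//; last exact/measurable_EFinP.
by rewrite -integral_mean.
Qed.

End product_law.

(** * Independence of a partial sum and the next variable *)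

(** A pi-system generating the sigma-algebra of the first i variables; the
    independence hypothesis evaluates P on it directly. *)
Definition past_events (R : realType) (d : measure_display)
    (T : measurableType d) (P : probability T R) (Ys : nat -> {RV P >-> R})
    (i : nat) : set (set T) :=
  [set B | exists2 A : nat -> set R, (forall j, measurable (A j)) &
    B = \bigcap_(j in `I_i) (Ys j @^-1` A j)].

Section past.
Context (R : realType) (d : measure_display) (T : measurableType d)
  (P : probability T R) (Ys : nat -> {RV P >-> R}).
Hypothesis ind : mutually_independent Ys.

Lemma past_events_measurable i : past_events Ys i `<=` measurable.
Proof.
move=> _ [A mA ->].
apply: fin_bigcap_measurable => [|j _]; first exact: finite_II.
by rewrite -[X in measurable X]setTI; apply: measurable_funPT.
Qed.

Lemma past_events_setT i : past_events Ys i setT.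
Proof.
exists (fun=> setT) => //; apply/esym/seteqP; split=> // w _ j _.
Qed.

Lemma past_events_setI i : setI_closed (past_events Ys i).
Proof.
move=> _ _ [A mA ->] [B mB ->]; exists (fun j => A j `&` B j).
  by move=> j; exact: measurableI.
by rewrite -bigcapI.
Qed.

(** The event on the left is an intersection over i + 1 indices, so the product
    rule over {0, ..., i} splits as that over {0, ..., i - 1} times the factor
    of index i. *)
Lemma past_events_independent i (B : set T) (C : set R) :
  past_events Ys i B -> measurable C ->
  P (B `&` Ys i @^-1` C) = (P B * P (Ys i @^-1` C))%E.
Proof.
move=> [A mA ->] mC.
pose J := [fset j in iota 0 i]%fset.
have JE j : (j \in J) = (j < i)%N by rewrite inE/= mem_iota add0n.
have iJ : i \notin J by rewrite JE ltnn.
have -> : \bigcap_(j in `I_i) (Ys j @^-1` A j) =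
          \bigcap_(j in [set` J]) (Ys j @^-1` A j).
  by apply: eq_bigcapl; split => j /=; rewrite JE.
pose A' j := if j == i then C else A j.
have mA' j : measurable (A' j) by rewrite /A'; case: ifP.
have A'J j : j \in J -> A' j = A j.
  by rewrite JE /A'; case: eqP => // ->; rewrite ltnn.
have := ind (J := (i |` J)%fset) (fun j _ => mA' j).
rewrite big_fsetU1//= {2}/A' eqxx muleC.
have -> : (\prod_(j <- J) P (Ys j @^-1` A' j) =
           \prod_(j <- J) P (Ys j @^-1` A j))%E.
  by apply: eq_big_seq => j jJ; rewrite A'J.
rewrite -ind// => <-; congr (P _); apply/seteqP; split => w /=.
  move=> [wJ wi] j /=; rewrite in_fset1U => /orP[/eqP ->|jJ].
    by rewrite /A' eqxx.
  by rewrite A'J//; exact: wJ.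
move=> wJ; split.
  by move=> j /= jJ; have := wJ j; rewrite /= A'J// in_fset1U jJ orbT; apply.
by have := wJ i; rewrite /A' eqxx; apply; rewrite /= in_fset1U eqxx.
Qed.

(** For fixed C both sides are finite measures in B, namely P restricted to
    the event Y_(i+1) in C and a multiple of P; they agree on the pi-system
    [past_events], hence on the sigma-algebra that it generates. *)
Lemma sigma_past_independent i (B : set T) (C : set R) :
  <<s past_events Ys i >> B -> measurable C ->
  P (B `&` Ys i @^-1` C) = (P B * P (Ys i @^-1` C))%E.
Proof.
move=> sB mC.
have mYC : measurable (Ys i @^-1` C).
  by rewrite -[X in measurable X]setTI; apply: measurable_funPT.
have c0 : 0 <= fine (P (Ys i @^-1` C)) by exact: fine_ge0.
rewrite -[LHS]/(mrestr P mYC B) muleC -(fineK (fin_num_measure P _ mYC)).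
rewrite -[RHS]/(mscale (NngNum c0) P B).
apply: (g_sigma_algebra_measure_unique _ _ (fun=> setT)) sB => //.
- exact: past_events_measurable.
- by move=> _; exact: past_events_setT.
- exact: bigcup_const.
- exact: past_events_setI.
- move=> A pA; rewrite -[LHS]/(P (A `&` Ys i @^-1` C)).
  rewrite -[RHS]/((fine (P (Ys i @^-1` C)))%:E * P A)%E.
  by rewrite past_events_independent// muleC fineK ?fin_num_measure.
- move=> _; rewrite -[X in (X < _)%E]/(P (setT `&` Ys i @^-1` C)) setTI.
  by rewrite (le_lt_trans (probability_le1 _ _))// ltry.
Qed.

(** The sum is measurable for the sigma-algebra generated by [past_events],
    since each of its terms is. *)
Lemma partial_sum_past i (A : set R) : measurable A ->
  <<s past_events Ys i >> (partial_sum Ys i @^-1` A).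
Proof.
move=> mA.
have mS : measurable_fun (setT : set (g_sigma_algebraType (past_events Ys i)))
    (fun w => \sum_(j < i) (Ys j w : R)).
  apply: measurable_sum => j _ B mB; rewrite setTI; apply: sub_gen_smallest.
  exists (fun k => if k == j :> nat then B else setT).
    by move=> k; case: ifP.
  apply/seteqP; split=> w /=.
    by move=> Bw k _ /=; case: eqP => //= ->.
  by move=> /(_ _ (ltn_ord j)) /=; rewrite eqxx.
by have := mS measurableT A mA; rewrite setTI.
Qed.

End past.

Lemma measurable_partial_sum (R : realType) (d : measure_display)
    (T : measurableType d) (P : probability T R) (Ys : nat -> {RV P >-> R})
    (i : nat) :
  measurable_fun [set: T] (partial_sum Ys i).
Proof. by apply: measurable_sum => j. Qed.

HB.instance Definition _ (R : realType) (d : measure_display)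
    (T : measurableType d) (P : probability T R) (Ys : nat -> {RV P >-> R})
    (i : nat) :=
  isMeasurableFun.Build _ _ _ _ (partial_sum Ys i)
    (measurable_partial_sum Ys i).

Lemma independent_partial_sum_next (R : realType) (d : measure_display)
    (T : measurableType d) (P : probability T R) (Ys : nat -> {RV P >-> R})
    (i : nat) : mutually_independent Ys ->
  independent_pair (partial_sum Ys i : {RV P >-> R}) (Ys i).
Proof.
move=> ind A C mA mC; apply: sigma_past_independent => //.
exact: partial_sum_past.
Qed.

(** * Moments of the partial sums *)

Lemma integrable_moment (R : realType) (d : measure_display)
    (T : measurableType d) (P : probability T R) (Y : {RV P >-> R}) (n : nat) :
  ('E_P[fun w => (`|Y w| ^+ n)%R] < +oo)%E ->
  P.-integrable setT (EFin \o (fun w => Y w ^+ n)).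
Proof.
move=> Yn; apply/integrableP; split.
  by apply/measurable_EFinP; exact: measurable_funX.
move: Yn; rewrite unlock; congr (_ < _)%E.
by apply: eq_integral => w _ /=; rewrite normrX.
Qed.

Section same_law.
Context (R : realType) (d0 : measure_display) (T0 : measurableType d0)
  (P0 : probability T0 R) (Y : {RV P0 >-> R}).
Context (d : measure_display) (T : measurableType d) (P : probability T R)
  (X : {RV P >-> R}).
Hypothesis XY : forall A : set R, measurable A ->
  distribution P X A = distribution P0 Y A.
Variable f : R -> R.
Hypothesis mf : measurable_fun setT f.
Hypothesis intY : P0.-integrable setT (EFin \o (f \o Y)).

Lemma same_law_integrable : P.-integrable setT (EFin \o (f \o X)).
Proof.
have /integrableP[_ Yoo] := intY.
apply/integrableP; split.
  by apply/measurable_EFinP; exact: measurableT_comp.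
have mabs : measurable_fun setT (fun y => `|f y|%:E).
  by apply/measurable_EFinP; exact: measurableT_comp.
move: Yoo; congr (_ < _)%E.
rewrite -[LHS](ge0_integral_distribution Y mabs)//.
rewrite -[RHS](ge0_integral_distribution X mabs)//.
by apply/esym/eq_measure_integral => A mA _; exact: XY.
Qed.

Lemma same_law_mean : mean P (f \o X) = mean P0 (f \o Y).
Proof.
have mEf : measurable_fun setT (EFin \o f) by exact/measurable_EFinP.
apply: EFin_inj; rewrite -!integral_mean//; last exact: same_law_integrable.
rewrite -[LHS](integral_distribution mEf same_law_integrable).
rewrite -[RHS](integral_distribution mEf intY).
by apply: eq_measure_integral => A mA _; exact: XY.
Qed.

End same_law.

Section moments.
Context (R : realType) (d : measure_display) (T : measurableType d)
  (P : probability T R) (Ys : nat -> {RV P >-> R}).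
Hypothesis ind : mutually_independent Ys.
Hypothesis intY : forall i n,
  P.-integrable setT (EFin \o (fun w => Ys i w ^+ n)).

Let mX n : measurable_fun setT (fun x : R => x ^+ n).
Proof. exact: exprn_measurable. Qed.

Lemma partial_sumS i w : partial_sum Ys i.+1 w = partial_sum Ys i w + Ys i w.
Proof. by rewrite /partial_sum big_ord_recr. Qed.

Lemma partial_sum_exprS i n w : partial_sum Ys i.+1 w ^+ n =
  \sum_(k < n.+1) 'C(n, k)%:R *
     (partial_sum Ys i w ^+ k * Ys i w ^+ (n - k)).
Proof.
rewrite partial_sumS addrC exprDn; apply: eq_bigr => k _.
by rewrite mulr_natl mulrC.
Qed.

(** Integrability of all moments passes from S_i to S_(i+1): the binomial
    expansion involves only products of independent integrable variables. *)
Lemma integrable_partial_sum i n :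
  P.-integrable setT (EFin \o (fun w => partial_sum Ys i w ^+ n)).
Proof.
elim: i n => [|i IH] n.
  rewrite (_ : _ \o _ = EFin \o cst (0 ^+ n)).
    exact: finite_measure_integrable_cst.
  by apply/funext => w /=; rewrite /partial_sum big_ord0.
rewrite (_ : _ \o _ = fun w => (\sum_(k < n.+1) ('C(n, k)%:R)%:E *
     (partial_sum Ys i w ^+ k * Ys i w ^+ (n - k))%:E)%E).
  apply: integrable_sum => // k _; apply: integrableZl => //.
  exact: (integrable_independentM (independent_partial_sum_next i ind)
    (mX k) (mX (n - k)) (IH k) (intY i (n - k))).
apply/funext => w /=; rewrite partial_sum_exprS -sumEFin.
by apply: eq_bigr => k _; rewrite EFinM.
Qed.

(** Expand (S_i + Y_(i+1))^n and use that the mean of a product of independent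
    variables is the product of the means. *)
Lemma mean_partial_sumS i n :
  mean P (fun w => partial_sum Ys i.+1 w ^+ n) =
  binconv (fun k => mean P (fun w => partial_sum Ys i w ^+ k))
          (fun k => mean P (fun w => Ys i w ^+ k)) n.
Proof.
have prodI k := integrable_independentM (independent_partial_sum_next i ind)
    (mX k) (mX (n - k)) (integrable_partial_sum i k) (intY i (n - k)).
apply: EFin_inj; rewrite -integral_mean; last exact: integrable_partial_sum.
transitivity (\int[P]_w (\sum_(k < n.+1) ('C(n, k)%:R)%:E *
     (partial_sum Ys i w ^+ k * Ys i w ^+ (n - k))%:E))%E.
  apply: eq_integral => w _; rewrite partial_sum_exprS -sumEFin.
  by apply: eq_bigr => k _; rewrite EFinM.
rewrite integral_sum//; last first.
  by move=> k; apply: integrableZl => //; exact: prodI.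
rewrite /binconv -sumEFin; apply: eq_bigr => k _.
rewrite integralZl//; last exact: prodI.
rewrite integral_mean; last exact: prodI.
rewrite -mulrA EFinM; congr (_ * _%:E)%E.
exact: (mean_independentM (independent_partial_sum_next i ind)
    (mX k) (mX (n - k)) (integrable_partial_sum i k) (intY i (n - k))).
Qed.

End moments.

(** * The recurrence *)

Theorem theorem2p1 (R : realType)
    (d0 : measure_display) (T0 : measurableType d0) (P0 : probability T0 R)
    (Y : {RV P0 >-> R})
    (d : measure_display) (T : measurableType d) (P : probability T R)
    (Ys : nat -> {RV P >-> R})
    (hY : class_G Y) (hYs : iid_copies Y Ys)
    (n : nat) (x : R) (hx : 0 <= x) :
  fubini_W Ys n.+1 x =
    x * \sum_(0 <= k < n.+1)
          'C(n, k)%:R * mean P0 (fun w => Y w ^+ (n - k + 1)) *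
          (\sum_(0 <= i < k.+1)
             'C(k, i)%:R * fubini_W Ys i x * fubini_W Ys (k - i) x).
Proof.
have [[momY _] [ind law]] := (hY, hYs).
have intY j := integrable_moment (momY j).
have mX j : measurable_fun setT (fun y : R => y ^+ j).
  exact: exprn_measurable.
have intYs i j := same_law_integrable (law i) (mX j) (intY j).
pose m j := mean P0 (fun w => Y w ^+ j).
pose a i k := mean P (fun w => partial_sum Ys i w ^+ k).
have mE i j : mean P (fun w => Ys i w ^+ j) = m j.
  exact (same_law_mean (law i) (mX j) (intY j)).
have m0 : m 0%N = 1 by exact: mean_cst.
have a0 k : a 0%N k = (k == 0%N)%:R.
  rewrite /a -expr0n -[RHS](mean_cst P); congr (mean P _).
  by apply/funext => w; rewrite /partial_sum big_ord0.
have aS i k : a i.+1 k = binconv (a i) m k.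
  rewrite /a mean_partial_sumS//; by apply: eq_bigr => j _; rewrite mE.
have x1 : 0 < 1 + x by rewrite ltr_wpDr.
pose p := (1 + x)^-1; pose q := x * p.
have p0 : p != 0 by rewrite invr_eq0 gt_eqF.
have qE : 1 - p = q by rewrite /q /p; field; rewrite gt_eqF.
have q0 : 0 <= q by rewrite /q /p divr_ge0// ltW.
have q1 : q < 1 by rewrite -qE gtrBl invr_gt0.
pose W k := fubini_W Ys k x.
have WE : W = fun k => limn (series (fun i => a i k * (p * q ^+ i))).
  by apply/funext => k; rewrite /W /fubini_W /= /eta qE.
have geoW k : W k = (k == 0%N)%:R * p + q * binconv W m k.
  by rewrite WE; exact: geometric_sum_binconv_iter.
have := binconv_riccati geoW n.
rewrite /q [x * p]mulrC -mulrA => /(mulfI p0).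
rewrite -/(W n.+1) => ->; congr (_ * _).
rewrite big_mkord; apply: eq_bigr => k _.
rewrite addn1 mulrAC; congr (_ * _).
by rewrite big_mkord; apply: eq_bigr.
Qed.
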